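(* Let $\mathcal{H}$ be a real Hilbert space and let $A:\mathcal{H}\to 2^{\mathcal{H}}$ be maximally monotone with $\operatorname{zer}A\neq\varnothing$. Let $x_0\in\mathcal{H}$, let $(\lambda_k)_{k\in\mathbb{N}}$ be in $\left]0,2\right[$, $(\eta_k)_{k\in\mathbb{N}}$ in $\mathbb{R}_+$, $(c_k)_{k\in\mathbb{N}}$ in $\mathbb{R}_{++}$, $(e_k)_{k\in\mathbb{N}}$ in $\mathcal{H}$, and let $$(\forall k\in\mathbb{N})\quad x_{k+1}=(1-\lambda_k)x_k+\lambda_k \operatorname{J}_{c_kA}x_k+\eta_ke_k .$$ Suppose that $A^{-1}$ is Lipschitz continuous at $0$ with modulus $\alpha>0$, i.e., $A^{-1}(0)=\{\bar{x}\}$ and there exists $\tau>0$ such that $\|x-\bar{x}\|\leq\alpha\|w\|$ for every $(w,x)\in\operatorname{gra}A^{-1}$ with $w\in B[0;\tau]$. Suppose that $\frac{1}{c_k}(x_k-\operatorname{J}_{c_kA}x_k)\to0$ (strongly). Let $(\varepsilon_k)_{k\in\mathbb{N}}$ be in $\mathbb{R}_+$ such that $\eta_k\varepsilon_k\to0$. Suppose that $(\forall k\in\mathbb{N})$ $\|e_k\|\leq\varepsilon_k\|x_k-x_{k+1}\|$, that $\liminf_{k\to\infty}c_k>0$, and that $0<\liminf_{k\to\infty}\lambda_k\leq\limsup_{k\to\infty}\lambda_k<2$. Set $$(\forall k\in\mathbb{N})\quad \rho_k:=\max\left\{\left(1-\frac{\lambda_k}{\frac{\alpha}{c_k}+1}\right)^2,\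 1-\lambda_k(2-\lambda_k)\frac{1}{1+\frac{\alpha^2}{c_k^2}}\right\}^{1/2}.$$ Then the following hold. (i) For every $k$ large enough, $\rho_k\in\left]0,1\right[$ and $\|x_{k+1}-\bar{x}\|\leq\frac{\rho_k+\eta_k\varepsilon_k}{1-\eta_k\varepsilon_k}\|x_k-\bar{x}\|$. (ii) There exist $\mu\in[0,1[$ and $K\in\mathbb{N}$ such that $(\forall k\geq K)$ $\|x_{k+1}-\bar{x}\|\leq\mu\|x_k-\bar{x}\|\leq\mu^{k-K+1}\|x_K-\bar{x}\|$.
   Context: $\mathbb{N}=\{0,1,2,\ldots\}$; $\mathbb{R}_+$ and $\mathbb{R}_{++}$ are the nonnegative and positive reals. $\operatorname{zer}A=A^{-1}(0)=\{x\in\mathcal{H}:0\in Ax\}$, and $\operatorname{gra}A^{-1}=\{(w,x)\in\mathcal{H}\times\mathcal{H}:w\in Ax\}$. The resolvent is $\operatorname{J}_{\gamma A}=(\operatorname{Id}+\gamma A)^{-1}$, which for maximally monotone $A$ and $\gamma>0$ is single-valued with full domain. $B[0;\tau]$ is the closed ball of center $0$ and radius $\tau$. *)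

(* Defs.v *)
From HB Require Import structures.
From mathcomp Require Import all_boot all_order all_algebra.
From mathcomp Require Import all_classical all_reals all_analysis.

Set Implicit Arguments.
Unset Strict Implicit.
Unset Printing Implicit Defensive.

Import Order.TTheory GRing.Theory Num.Theory.
Import numFieldNormedType.Exports.
Local Open Scope classical_set_scope.
Local Open Scope ring_scope.

(* A set-valued operator A : H -> 2^H is a function A : H -> set H,
   so that A x u reads u \in A x. *)

Section set_valued_operators.
Context {R : realType} {H : completeNormedModType R}.
Implicit Types A B : H -> set H.

Definition gra A : set (H * H) := [set p | A p.1 p.2].

Definition op_inv A : H -> set H := fun u => [set x | A x u].

Definition zer A : set H := op_inv A 0.

Definition op_add A B : H -> set H :=
  fun x => [set w | exists2 u, A x u & exists2 v, B x v & w = u + v].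

Definition op_scale (g : R) A : H -> set H :=
  fun x => [set w | exists2 u, A x u & w = g *: u].

Definition op_id : H -> set H := fun x => [set x].

(* (Id + g A)^-1 as a set-valued operator. *)
Definition set_resolvent (g : R) A : H -> set H :=
  op_inv (op_add op_id (op_scale g A)).

(* The element of (Id + g A)^-1 x.  For A maximally monotone and 0 < g there
   is exactly one (Minty); the default value 0 is returned only when there is
   none. *)
Definition resolvent (g : R) A : H -> H := fun x => xget 0 (set_resolvent g A x).

Definition monotone_op (ip : {dot H for idfun}) A :=
  forall x u y v, gra A (x, u) -> gra A (y, v) -> 0 <= ip (x - y) (u - v).

Definition maximally_monotone (ip : {dot H for idfun}) A :=
  monotone_op ip A /\
  forall B, monotone_op ip B -> gra A `<=` gra B -> gra B = gra A.

(* B is Lipschitz continuous at 0 with modulus alpha and B 0 = {b}. *)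
Definition lipschitz_at0 (alpha : R) B (b : H) :=
  B 0 = [set b] /\
  exists2 tau : R, 0 < tau &
    forall w x, gra B (w, x) -> closed_ball 0 tau w ->
      `|x - b| <= alpha * `|w|.

End set_valued_operators.

(* Main.v *)
(* Minty: the sum of the Fitzpatrick function of A and of half the squared norm
   of H x H is nonnegative and strongly convex, so it has a minimiser (x, w),
   and the quadratic growth at the minimiser says that (-w, -x) is monotonically
   related to A with slack |x + w|^2.  By maximality (-w, -x) lies in the graph
   of A, whence w = -x and -x is in A x; translating and scaling A gives the
   existence of every resolvent.

   Contraction: put q = J x - xbar and d = x - J x.  Then <q, d> >= 0 and, once
   the residual is small, |q| <= (alpha / c) |d|.  The inequality
   |q + (1 - l) d|^2 <= rho^2 |q + d|^2 is affine in |q|^2 and <q, d>, so it need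
   only be checked at |q| = (alpha / c) |d| and at the two extreme values of
   <q, d>, which account for the two members of the maximum defining rho. *)
Require Import Defs.
From HB Require Import structures.
From mathcomp Require Import all_boot all_order all_algebra.
From mathcomp Require Import all_classical all_reals all_analysis.
From mathcomp Require Import ring lra.

Set Implicit Arguments.
Unset Strict Implicit.
Unset Printing Implicit Defensive.

Import Order.TTheory GRing.Theory Num.Theory.
Import numFieldNormedType.Exports.
Local Open Scope classical_set_scope.
Local Open Scope ring_scope.

(** * Inner product: continuity and a Cauchy criterion *)

Section inner_product.
Context {R : realType} {H : completeNormedModType R} (ip : {dot H for idfun}).
Implicit Types (a b u v x y : H) (r s : R).

Lemma ipC u v : ip u v = ip v u.
Proof. by rewrite hermC /= expr0 mul1r. Qed.

Lemma ip0l x : ip 0 x = 0.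
Proof. exact: linear0l. Qed.

Lemma ipDl u v x : ip (u + v) x = ip u x + ip v x.
Proof. exact: linearDl. Qed.

Lemma ipDr u v x : ip x (u + v) = ip x u + ip x v.
Proof. exact: linearDr. Qed.

Lemma ipBl u v x : ip (u - v) x = ip u x - ip v x.
Proof. exact: linearBl. Qed.

Lemma ipBr u v x : ip x (u - v) = ip x u - ip x v.
Proof. exact: linearBr. Qed.

Lemma ipNl u x : ip (- u) x = - ip u x.
Proof. exact: linearNl. Qed.

Lemma ipNr u x : ip x (- u) = - ip x u.
Proof. exact: linearNr. Qed.

Lemma ipZl r u x : ip (r *: u) x = r * ip u x.
Proof. exact: linearZl_LR. Qed.

Lemma ipZr r u x : ip x (r *: u) = r * ip x u.
Proof. exact: linearZr_LR. Qed.

Definition ipE := (ipDl, ipDr, ipBl, ipBr, ipNl, ipNr, ipZl, ipZr).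

Hypothesis ip_norm : forall z : H, `|z| = Num.sqrt (ip z z).

Lemma ip_ge0 u : 0 <= ip u u.
Proof.
have [->|u0] := eqVneq u 0; last exact/ltW/neq0_dnorm_gt0.
by rewrite ip0l.
Qed.

Lemma sqr_norm u : `|u| ^+ 2 = ip u u.
Proof. by rewrite ip_norm sqr_sqrtr// ip_ge0. Qed.

Lemma ip_polarization u v : ip u v = (`|u + v| ^+ 2 - `|u - v| ^+ 2) / 4.
Proof. by rewrite !sqr_norm !ipE (ipC v u); field. Qed.

(** Polarization reduces joint continuity to continuity of the norm. *)
Lemma cvg_ip (f g : nat -> H) a b :
  f @ \oo --> a -> g @ \oo --> b -> (fun n => ip (f n) (g n)) @ \oo --> ip a b.
Proof.
move=> fa gb; rewrite ip_polarization.
under eq_fun do rewrite ip_polarization.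
apply: cvgMl; apply: cvgB; rewrite expr2; under eq_fun do rewrite expr2.
  by apply: cvgM; apply: cvg_norm; apply: cvgD.
by apply: cvgM; apply: cvg_norm; apply: cvgB.
Qed.

(** Completeness of [H] enters here, to give minimising sequences a limit. *)
Lemma cvg_harmonic_cauchy (f : nat -> H) (C : R) :
  (forall m n, (m <= n)%N -> ip (f m - f n) (f m - f n) <= C * m.+1%:R^-1) ->
  cvgn f.
Proof.
move=> fC; apply: cauchy_cvg; apply: cauchy_exP => e e0.
have C0 : 0 < `|C| + 1 by rewrite ltr_wpDl.
have e2 : 0 < e ^+ 2 / (`|C| + 1) by rewrite divr_gt0// exprn_gt0.
have [N _ /(_ N (leqnn N)) hN] := near_infty_natSinv_lt (PosNum e2).
exists (f N); exists N => // n /= Nn.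
rewrite -ball_normE /= -(@ltr_pXn2r _ 2)// ?nnegrE ?(ltW e0)// sqr_norm.
apply: (le_lt_trans (fC _ _ Nn)).
move: hN; rewrite /= ltr_pdivlMr// mulrC; apply: le_lt_trans.
by rewrite ler_wpM2r// ?invr_ge0 ?ler0n// (le_trans (ler_norm C))// lerDl.
Qed.

End inner_product.

(** * Minty's theorem through the Fitzpatrick function *)

Section minty.
Context {R : realType} {H : completeNormedModType R} (ip : {dot H for idfun}).
Hypothesis ip_norm : forall z : H, `|z| = Num.sqrt (ip z z).
Implicit Types (A : H -> set H) (x y u v w : H) (r s t : R).

(** Adjoining (x, u) to the graph keeps it monotone, so maximality forces the pair to be there
    already. *)
Lemma maximally_monotone_mem A x u : maximally_monotone ip A ->
  (forall y v, A y v -> 0 <= ip (x - y) (u - v)) -> A x u.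
Proof.
move=> [Amon Amax] xu.
pose B y : set H := [set v | A y v \/ (y = x /\ v = u)].
have Bmon : monotone_op ip B.
  move=> a b a' b' [/= Aab|[/= -> ->]] [/= Aab'|[/= -> ->]].
  - exact: Amon.
  - by rewrite -opprB -(opprB u) ipNl ipNr opprK; apply: xu.
  - exact: xu.
  - by rewrite !subrr (ip_ge0 ip).
have AB : gra A `<=` gra B by move=> -[a b] Aab; left.
suff : gra B (x, u) by rewrite (Amax _ Bmon AB).
by right.
Qed.

(* The epigraph of the sum of the Fitzpatrick function of [A] and of half the
   squared norm of H x H. *)
Definition fitzpatrick_epi A x w t := forall y v, A y v ->
  ip x v + ip y w - ip y v + (ip x x + ip w w) / 2 <= t.

(** For fixed (y, v) the constraint is affine in (x, w) plus half the squared norm, and the latter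
    yields exactly the subtracted gain. *)
Lemma fitzpatrick_epi_convex A x w t x' w' t' s : 0 <= s <= 1 ->
  fitzpatrick_epi A x w t -> fitzpatrick_epi A x' w' t' ->
  fitzpatrick_epi A ((1 - s) *: x + s *: x') ((1 - s) *: w + s *: w')
    ((1 - s) * t + s * t'
     - s * (1 - s) / 2 * (ip (x - x') (x - x') + ip (w - w') (w - w'))).
Proof.
move=> /andP[s0 s1] E E' y v Ayv.
have := ler_wpM2l s0 (E' _ _ Ayv).
have : 0 <= 1 - s by rewrite subr_ge0.
move=> /ler_wpM2l/(_ _ _ (E _ _ Ayv)).
rewrite !ipE (ipC ip x' x) (ipC ip w' w) => h h'.
rewrite -subr_ge0 in h; rewrite -subr_ge0 in h'.
rewrite -subr_ge0; apply: le_trans (addr_ge0 h h') _.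
by rewrite le_eqVlt; apply/orP; left; apply/eqP; field.
Qed.

Section zero_of_id_add.
Variable A : H -> set H.
Hypothesis Amon : monotone_op ip A.
Hypothesis Amem : forall x u,
  (forall y v, A y v -> 0 <= ip (x - y) (u - v)) -> A x u.

(** The non-quadratic terms equal <x, w> - <x - y, w - v>, so one graph point with <x - y, w - v> <=
    0 suffices. Were there none, (x, w) would be monotonically related to the graph, hence a graph
    point itself. *)
Lemma fitzpatrick_epi_ge x w t : fitzpatrick_epi A x w t ->
  ip (x + w) (x + w) / 2 <= t.
Proof.
move=> E; suff [y [v [Ayv xwyv]]] :
    exists y v, A y v /\ ip (x - y) (w - v) <= 0.
  move: xwyv (E _ _ Ayv); rewrite !ipE (ipC ip w x); lra.
have [Axw|nAxw] := pselect (A x w).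
  by exists x, w; rewrite subrr ip0l.
apply: contrapT => nyv; apply: nAxw; apply: Amem => y v Ayv.
by rewrite leNgt; apply/negP => /ltW ?; apply: nyv; exists y, v.
Qed.

Lemma fitzpatrick_epi_graph y v : A y v ->
  fitzpatrick_epi A y v (ip (y + v) (y + v) / 2).
Proof.
move=> Ayv y' v' Ayv'.
have /= := Amon (Ayv : gra A (y, v)) (Ayv' : gra A (y', v')).
rewrite !ipE (ipC ip v y); lra.
Qed.

Let values : set R := [set t | exists x w, fitzpatrick_epi A x w t].

Let has_inf_values : has_inf values.
Proof.
split; last first.
  exists 0 => t [x [w /fitzpatrick_epi_ge]]; apply: le_trans.
  by rewrite divr_ge0// ip_ge0.
(* An empty graph would satisfy the premise of [Amem] vacuously and so contain (0, 0). *)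
have [y [v Ayv]] : exists y v, A y v.
  apply: contrapT => An; apply: (An); exists 0, 0; apply: Amem => y v Ayv.
  by exfalso; apply: An; exists y, v.
by exists (ip (y + v) (y + v) / 2), y, v; exact: fitzpatrick_epi_graph.
Qed.

Let m := inf values.

Let m_le x w t : fitzpatrick_epi A x w t -> m <= t.
Proof.
by move=> E; apply: ge_inf; [exact: has_inf_values.2 | exists x, w].
Qed.

Lemma fitzpatrick_epi_min : exists x w, fitzpatrick_epi A x w m.
Proof.
have /choice[z zE] (n : nat) :
    exists p : H * H, fitzpatrick_epi A p.1 p.2 (m + n.+1%:R^-1).
  have [|t [x [w E]] tm] := @inf_adherent _ values n.+1%:R^-1 _ has_inf_values.
    by rewrite invr_gt0.
  by exists (x, w) => y v Ayv; exact: le_trans (E _ _ Ayv) (ltW tm).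
(* With Q the left side, strong convexity at the midpoint gives Q / 8 <= (1/(k+1) + 1/(n+1)) / 2 <=
   1/(k+1). *)
have zC k n : (k <= n)%N ->
    ip ((z k).1 - (z n).1) ((z k).1 - (z n).1)
    + ip ((z k).2 - (z n).2) ((z k).2 - (z n).2) <= 8 * k.+1%:R^-1.
  move=> kn; have half : 0 <= (2^-1 : R) <= 1 by lra.
  have := m_le (fitzpatrick_epi_convex half (zE k) (zE n)).
  have : (n.+1%:R^-1 : R) <= k.+1%:R^-1 by rewrite lef_pV2 ?posrE// ler_nat.
  move: (n.+1%:R^-1) (k.+1%:R^-1) => a b ab; set Q := ip _ _ + _.
  lra.
have /cvg_ex[x zx] : cvgn (fun n => (z n).1).
  apply: (@cvg_harmonic_cauchy _ _ ip ip_norm _ 8) => k n /zC.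
  by apply: le_trans; rewrite lerDl ip_ge0.
have /cvg_ex[w zw] : cvgn (fun n => (z n).2).
  apply: (@cvg_harmonic_cauchy _ _ ip ip_norm _ 8) => k n /zC.
  by apply: le_trans; rewrite lerDr ip_ge0.
exists x, w => y v Ayv.
have bound_cvg : (fun n => m + n.+1%:R^-1) @ \oo --> m.
  rewrite -[X in _ --> X]addr0.
  by apply: cvgD; [exact: cvg_cst|exact: cvg_harmonic].
(* The epigraph is closed: each of its constraints passes to the limit. *)
apply: (ler_cvg_to _ bound_cvg); last first.
  by apply: nearW => n; exact: zE n _ _ Ayv.
apply: cvgD; last by apply: cvgMl; apply: cvgD; exact: cvg_ip.
by apply: cvgB; [apply: cvgD|]; apply: cvg_ip => //; exact: cvg_cst.
Qed.

Lemma fitzpatrick_epi_min_quadratic x w x' w' t :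
  fitzpatrick_epi A x w m -> fitzpatrick_epi A x' w' t ->
  m + (ip (x - x') (x - x') + ip (w - w') (w - w')) / 2 <= t.
Proof.
move=> E E'; set Q := ip _ _ + _.
have Q0 : 0 <= Q by rewrite addr_ge0// ip_ge0.
rewrite leNgt; apply/negP => mt; pose d := m + Q / 2 - t.
have d0 : 0 < d by rewrite subr_gt0.
have dQ : 0 < d + Q by rewrite ltr_pwDl.
(* Moving by s towards (x', w') gives d <= s * Q / 2. Instead of letting s tend to 0, this s is
   already small enough to contradict d > 0. *)
pose s := d / (d + Q).
have s01 : 0 <= s <= 1.
  by rewrite divr_ge0 ?(ltW d0) ?(ltW dQ)//= ler_pdivrMr// mul1r lerDl.
have := m_le (fitzpatrick_epi_convex s01 E E'); rewrite -/Q => mE.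
have : s * (d - s * Q / 2) <= 0 by rewrite /d; lra.
have s0 : 0 < s by rewrite divr_gt0.
rewrite pmulr_rle0// subr_le0 => dsQ.
have : d * (d + Q) <= d * Q / 2.
  rewrite -ler_pdivlMr// (le_trans dsQ)// /s le_eqVlt; apply/orP; left.
  by apply/eqP; field; rewrite gt_eqF.
nra.
Qed.

Lemma zer_id_add : exists x, A x (- x).
Proof.
have [x [w E]] := fitzpatrick_epi_min.
have xw := fitzpatrick_epi_ge E.
(* Quadratic growth is tested against the graph point (y, v), and m is bounded below by |x + w|^2 /
   2. *)
have yv_ge y v : A y v -> ip (x + w) (x + w) <= ip (- w - y) (- x - v).
  move=> /fitzpatrick_epi_graph/(fitzpatrick_epi_min_quadratic E).
  move: xw.
  rewrite !ipE (ipC ip w x) (ipC ip y x) (ipC ip v w) (ipC ip v y); lra.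
have Awx : A (- w) (- x).
  by apply: Amem => y v /yv_ge; apply: le_trans; rewrite ip_ge0.
have := yv_ge _ _ Awx; rewrite subrr ip0l -(sqr_norm ip_norm).
rewrite exprn_even_le0//= normr_eq0 addr_eq0 => /eqP xE.
by exists x; rewrite {1}xE.
Qed.

End zero_of_id_add.

Lemma set_resolvent_nonempty A g x : maximally_monotone ip A -> 0 < g ->
  set_resolvent g A x !=set0.
Proof.
move=> Amax g0.
(* [B] is g A - x, so that - y in B y means x - y in g A y. It inherits from [A] both monotonicity
   and the maximality property [Amem]. *)
pose B y : set H := [set w | A y (g^-1 *: (w + x))].
have gK v : g *: (g^-1 *: v) = v by rewrite scalerA divff ?scale1r// gt_eqF.
have [|y u yuB|y By] := @zer_id_add B.
- move=> a b a' b' /= Bab Bab'.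
  have := Amax.1 a (g^-1 *: (b + x)) a' (g^-1 *: (b' + x)) Bab Bab'.
  by rewrite -scalerBr opprD addrACA subrr addr0 ipZr pmulr_rge0// invr_gt0.
- apply: (maximally_monotone_mem Amax) => a b Aab.
  rewrite -(pmulr_rge0 _ g0) -ipZr scalerBr gK.
  have -> : u + x - g *: b = u - (g *: b - x) by rewrite opprB addrA.
  apply: yuB; rewrite /B /= subrK.
  by rewrite scalerA mulVf ?scale1r// gt_eqF.
exists y; rewrite /set_resolvent /op_inv /op_add /=.
exists y => //; exists (x - y); last by rewrite addrC subrK.
by exists (g^-1 *: (- y + x)); rewrite ?gK// addrC.
Qed.

Lemma resolventP A g x : maximally_monotone ip A -> 0 < g ->
  A (resolvent g A x) (g^-1 *: (x - resolvent g A x)).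
Proof.
move=> Amax g0.
have [_ -> [_ [u Au ->]] xE] := xgetPex 0 (set_resolvent_nonempty x Amax g0).
rewrite [X in _ *: (X - _)]xE /resolvent addrC addKr scalerA mulVf ?gt_eqF//.
by rewrite scale1r.
Qed.

End minty.

(** * Eventual uniform bounds from strict bounds on upper and lower limits *)

Lemma limn_esup_lt_near {R : realType} (u : nat -> R) (a : R) :
  (limn_esup (fun k => (u k)%:E) < a%:E)%E ->
  exists2 b, b < a & \forall k \near \oo, u k <= b.
Proof.
move=> /ereal_inf_lt[_ /= [V VF <-]] ua.
have [N _ NV] := VF.
have uV k : (N <= k)%N -> ((u k)%:E <= ereal_sup ((fun k => (u k)%:E) @` V))%E.
  by move=> Nk; apply: ereal_sup_ubound; exists k => //; exact: NV.
(* The supremum of the tail is below a, which excludes +oo; it dominates a real term, which excludes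
   -oo. *)
case: (ereal_sup _) ua uV => [b| |] //= ba uV.
- exists b; rewrite -?lte_fin//.
  by exists N => // k Nk; rewrite -lee_fin; exact: uV.
- by have := uV _ (leqnn N).
Qed.

Lemma limn_einf_gt_near {R : realType} (u : nat -> R) (a : R) :
  (a%:E < limn_einf (fun k => (u k)%:E))%E ->
  exists2 b, a < b & \forall k \near \oo, b <= u k.
Proof.
rewrite /limn_einf lteNr => /(@limn_esup_lt_near _ (fun k => - u k) (- a)).
move=> [b ba bu]; exists (- b); first by rewrite ltrNr.
by near do rewrite lerNl.
Unshelve. all: by end_near. Qed.

(** * Contraction factor of one exact relaxed step *)

Section relaxed_contraction.
Context {R : realType}.
Implicit Types (b l : R).

(** This is the square of rho, with b standing for alpha / c. *)
Definition sqr_rate b l : R :=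
  Num.max ((1 - l / (b + 1)) ^+ 2) (1 - l * (2 - l) * (1 / (1 + b ^+ 2))).

Lemma sqr_rate_gt0 b l : 0 < b -> 0 < l < 2 -> 0 < sqr_rate b l.
Proof.
move=> b0 /andP[l0 l2]; rewrite /sqr_rate lt_max; apply/orP; right.
have b1 : 0 < 1 + b ^+ 2 by nra.
rewrite subr_gt0 mul1r ltr_pdivrMr// mul1r.
have := sqr_ge0 (1 - l); have : 0 < b ^+ 2 by rewrite exprn_gt0.
lra.
Qed.

(** A bound uniform in b and l keeps the rates away from 1. With t = l / (b + 1) the first member is
    1 - t (2 - t), and both factors of t (2 - t) are bounded below; the second member uses 1 + b^2
    <= (1 + b1)^2. *)
Lemma sqr_rate_le b l b1 l0 l1 : 0 < b <= b1 -> 0 < l0 <= l -> l <= l1 < 2 ->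
  sqr_rate b l <= 1 - l0 * (2 - l1) / (1 + b1) ^+ 2.
Proof.
move=> /andP[b0 bb1] /andP[l00 l0l] /andP[ll1 l12].
have b10 : 0 < 1 + b1 by lra.
have b1K : 0 <= (1 + b1)^-1 <= 1 by rewrite invr_ge0 ltW//= invf_le1//; lra.
rewrite /sqr_rate ge_max; apply/andP; split.
  have t0 : l0 / (1 + b1) <= l / (b + 1).
    by rewrite ler_pM ?invr_ge0 ?(ltW l00) ?(ltW b10)// lef_pV2 ?posrE; lra.
  have t1 : l / (b + 1) <= l1.
    by rewrite ler_pdivrMr; nra.
  have : l0 / (1 + b1) * ((2 - l1) / (1 + b1)) <=
         l / (b + 1) * (2 - l / (b + 1)).
    apply: ler_pM => //; first by rewrite divr_ge0 ?(ltW l00) ?(ltW b10).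
      by rewrite divr_ge0 ?(ltW b10)//; lra.
    apply: (@le_trans _ _ (2 - l1)); last lra.
    by rewrite ler_piMr//; [lra|case/andP: b1K].
  rewrite mulrACA -invfM -expr2; nra.
rewrite lerD2l lerN2 mul1r; apply: ler_pM.
- by rewrite mulr_ge0//; lra.
- by rewrite invr_ge0 sqr_ge0.
- by apply: ler_pM; lra.
- by rewrite lef_pV2 ?posrE; nra.
Qed.

Lemma sqr_rate_lt1 b l : 0 < b -> 0 < l < 2 -> sqr_rate b l < 1.
Proof.
move=> b0 /andP[l0 l2].
apply: (@le_lt_trans _ _ (1 - l * (2 - l) / (1 + b) ^+ 2)).
  by apply: sqr_rate_le; rewrite ?b0 ?l0 ?lexx.
by rewrite ltrBlDr ltrDl divr_gt0 ?mulr_gt0 ?exprn_gt0//; lra.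
Qed.

Lemma relaxed_step_le {H : completeNormedModType R} (ip : {dot H for idfun})
    (q d : H) b l : 0 < b -> 0 < l < 2 ->
  0 <= ip q d -> ip q q <= b ^+ 2 * ip d d ->
  ip (q + (1 - l) *: d) (q + (1 - l) *: d) <=
    sqr_rate b l * ip (q + d) (q + d).
Proof.
move=> b0 l02; have := sqr_rate_lt1 b0 l02.
have r1 : (1 - l / (b + 1)) ^+ 2 <= sqr_rate b l by rewrite le_max lexx.
have r2 : 1 - l * (2 - l) * (1 / (1 + b ^+ 2)) <= sqr_rate b l.
  by rewrite le_max lexx orbT.
move: r1 r2; move: (sqr_rate b l) => r r1 r2 r_lt1.
have := ip_ge0 ip (q - b *: d); have := ip_ge0 ip d.
rewrite !ipE (ipC ip d q).
move: (ip q q) (ip q d) (ip d d) => Q s D D0 + s0 QD.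
(* Up to the factor D, this is the desired inequality at Q = b^2 D, s = b D; [r2] below is the one
   at Q = b^2 D, s = 0. *)
have {r1} r1 : (b + 1 - l) ^+ 2 <= r * (b + 1) ^+ 2.
  have -> : (b + 1 - l) ^+ 2 = (1 - l / (b + 1)) ^+ 2 * (b + 1) ^+ 2.
    by field; lra.
  by rewrite ler_wpM2r// sqr_ge0.
have {r2} r2 : b ^+ 2 + (1 - l) ^+ 2 <= r * (1 + b ^+ 2).
  have b1 : 0 < 1 + b ^+ 2 by nra.
  have -> : b ^+ 2 + (1 - l) ^+ 2 =
      (1 - l * (2 - l) * (1 / (1 + b ^+ 2))) * (1 + b ^+ 2).
    by field; rewrite gt_eqF.
  by rewrite ler_wpM2r// ltW.
move=> sD.
(* Expanding |q - b d|^2 >= 0 gives 2 b s <= Q + b^2 D <= 2 b^2 D. *)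
have {sD} sD : s <= b * D by rewrite -(ler_pM2l b0); lra.
have QDr : (1 - r) * Q <= (1 - r) * (b ^+ 2 * D) by rewrite ler_wpM2l//; lra.
(* The difference of the two sides has slope 2 (1 - l - r) in s, whose sign tells which end of
   [0, b D] is the worst case. *)
have [lr|/ltW lr] := lerP (1 - l - r) 0.
  have : (1 - l - r) * s <= 0 by rewrite mulr_le0_ge0.
  have := ler_wpM2r D0 r2; nra.
have : (1 - l - r) * s <= (1 - l - r) * (b * D) by rewrite ler_wpM2l.
have := ler_wpM2r D0 r1; nra.
Qed.

End relaxed_contraction.

Lemma relaxed_resolvent_contraction {R : realType} {H : completeNormedModType R}
    (ip : {dot H for idfun}) (ip_norm : forall z : H, `|z| = Num.sqrt (ip z z))
    (A : H -> set H) (alpha c l : R) (x xbar : H) :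
  maximally_monotone ip A -> 0 < alpha -> 0 < c -> 0 < l < 2 -> A xbar 0 ->
  `|resolvent c A x - xbar| <= alpha * `|c^-1 *: (x - resolvent c A x)| ->
  `|(1 - l) *: x + l *: resolvent c A x - xbar| <=
    Num.sqrt (sqr_rate (alpha / c) l) * `|x - xbar|.
Proof.
move=> Amax alpha0 c0 l02 A0; have := resolventP ip_norm x Amax c0.
set J := resolvent c A x => AJ Jx.
have b0 : 0 < alpha / c by rewrite divr_gt0.
have -> : x - xbar = (J - xbar) + (x - J) by rewrite [RHS]addrC addrA subrK.
have -> : (1 - l) *: x + l *: J - xbar = (J - xbar) + (1 - l) *: (x - J).
  have {1}-> : l *: J = J - (1 - l) *: J.
    by rewrite scalerBl scale1r opprB addrC subrK.
  by rewrite scalerBr [RHS]addrC [J - _ *: J]addrC !addrA.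
rewrite -(@ler_pXn2r _ 2) ?nnegrE ?mulr_ge0 ?sqrtr_ge0//.
rewrite exprMn sqr_sqrtr ?(ltW (sqr_rate_gt0 b0 l02))// !(sqr_norm ip_norm).
apply: relaxed_step_le => //.
  have := Amax.1 J _ xbar _ AJ A0.
  by rewrite subr0 ipZr pmulr_rge0// invr_gt0.
rewrite -!(sqr_norm ip_norm) -exprMn ler_pXn2r ?nnegrE ?(mulr_ge0 (ltW b0))//.
by apply: (le_trans Jx); rewrite normrZ gtr0_norm ?invr_gt0// mulrA.
Qed.

(** * Linear convergence of the inexact iteration *)

Theorem theorem5p9 (R : realType) (H : completeNormedModType R)
    (ip : {dot H for idfun})
    (ip_norm : forall z : H, `|z| = Num.sqrt (ip z z))
    (A : H -> set H)
    (Amax : maximally_monotone ip A)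
    (zerA : zer A !=set0)
    (x : nat -> H) (lambda eta c : nat -> R) (e : nat -> H)
    (lambda02 : forall k, 0 < lambda k < 2)
    (eta_ge0 : forall k, 0 <= eta k)
    (c_gt0 : forall k, 0 < c k)
    (x_rec : forall k, x k.+1 =
      (1 - lambda k) *: x k + lambda k *: resolvent (c k) A (x k)
        + eta k *: e k)
    (alpha : R) (alpha_gt0 : 0 < alpha) (xbar : H)
    (invA_lip : lipschitz_at0 alpha (op_inv A) xbar)
    (residual_cvg0 :
      (fun k => (c k)^-1 *: (x k - resolvent (c k) A (x k))) @ \oo --> (0 : H))
    (eps : nat -> R)
    (eps_ge0 : forall k, 0 <= eps k)
    (eta_eps_cvg0 : (fun k => eta k * eps k) @ \oo --> (0 : R))
    (e_le : forall k, `|e k| <= eps k * `|x k - x k.+1|)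
    (c_liminf : (0 < limn_einf (fun k => (c k)%:E))%E)
    (lambda_liminf : (0 < limn_einf (fun k => (lambda k)%:E))%E)
    (lambda_liminf_limsup :
      (limn_einf (fun k => (lambda k)%:E) <=
       limn_esup (fun k => (lambda k)%:E))%E)
    (lambda_limsup : (limn_esup (fun k => (lambda k)%:E) < 2%:E)%E)
    (rho : nat -> R)
    (rhoE : forall k, rho k = Num.sqrt (Num.max
      ((1 - lambda k / (alpha / c k + 1)) ^+ 2)
      (1 - lambda k * (2 - lambda k) * (1 / (1 + alpha ^+ 2 / c k ^+ 2))))) :
  (\forall k \near \oo,
     0 < rho k < 1 /\
     `|x k.+1 - xbar| <=
       (rho k + eta k * eps k) / (1 - eta k * eps k) * `|x k - xbar|) /\
  (exists (mu : R) (K : nat), 0 <= mu < 1 /\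
     forall k, (K <= k)%N ->
       `|x k.+1 - xbar| <= mu * `|x k - xbar| /\
       mu * `|x k - xbar| <= mu ^+ (k - K + 1)%N * `|x K - xbar|).
Proof.
set theta := fun k => eta k * eps k in eta_eps_cvg0.
have theta_ge0 k : 0 <= theta k by rewrite mulr_ge0.
have b_gt0 k : 0 < alpha / c k by rewrite divr_gt0.
have {}rhoE k : rho k = Num.sqrt (sqr_rate (alpha / c k) (lambda k)).
  by rewrite rhoE /sqr_rate expr_div_n.
have rho01 k : 0 < rho k < 1.
  rewrite rhoE sqrtr_gt0 sqr_rate_gt0//= -[ltRHS]sqrtr1 ltr_sqrt//.
  exact: sqr_rate_lt1.
have [invA0 [tau tau0 Alip]] := invA_lip.
have A0 : A xbar 0 by have : op_inv A 0 xbar by rewrite invA0.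
(* The exact step contracts once the residual has norm below tau; the error is at most theta |x_k -
   x_{k+1}|, split at xbar by the triangle inequality. *)
have step : \forall k \near \oo, `|x k.+1 - xbar| <=
    rho k * `|x k - xbar| + theta k * (`|x k - xbar| + `|x k.+1 - xbar|).
  have tau_norm0 : `|0 : H| < tau by rewrite normr0.
  near=> k.
  have wk : `|(c k)^-1 *: (x k - resolvent (c k) A (x k))| < tau.
    by near: k; exact: cvgr_norm_lt _ residual_cvg0 _ tau_norm0.
  have Jk : `|resolvent (c k) A (x k) - xbar| <=
      alpha * `|(c k)^-1 *: (x k - resolvent (c k) A (x k))|.
    apply: Alip; first exact: (resolventP ip_norm).
    by apply: subset_closed_ball; rewrite -ball_normE /= sub0r normrN.
  have := relaxed_resolvent_contraction ip_norm Amax alpha_gt0 (c_gt0 k)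
    (lambda02 k) A0 Jk.
  rewrite -rhoE => stepk.
  rewrite {1}x_rec addrAC (le_trans (ler_normD _ _))// lerD//.
  rewrite normrZ ger0_norm// (le_trans (ler_wpM2l (eta_ge0 k) (e_le k)))//.
  rewrite mulrA -/(theta k) ler_wpM2l//.
  have -> : x k - x k.+1 = (x k - xbar) - (x k.+1 - xbar).
    by rewrite opprB addrA subrK.
  exact: ler_normB.
have step_ratio : \forall k \near \oo, theta k < 1 -> `|x k.+1 - xbar| <=
    (rho k + theta k) / (1 - theta k) * `|x k - xbar|.
  near=> k => th1.
  have stepk : `|x k.+1 - xbar| <= rho k * `|x k - xbar|
      + theta k * (`|x k - xbar| + `|x k.+1 - xbar|) by near: k.
  rewrite mulrAC ler_pdivlMr ?subr_gt0//; lra.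
split.
  have theta_lt1 := cvgr_lt _ eta_eps_cvg0 _ ltr01.
  near=> k; split; first exact: rho01.
  suff : theta k < 1 by near: k; exact: step_ratio.
  by near: k; exact: theta_lt1.
have [c0 c0_gt0 c0_le] := limn_einf_gt_near c_liminf.
have [l0 l0_gt0 l0_le] := limn_einf_gt_near lambda_liminf.
have [l1 l1_lt2 l1_ge] := limn_esup_lt_near lambda_limsup.
pose r := Num.sqrt (1 - l0 * (2 - l1) / (1 + alpha / c0) ^+ 2).
have r_lt1 : r < 1.
  rewrite -[ltRHS]sqrtr1 ltr_sqrt// ltrBlDr ltrDl divr_gt0//.
    by rewrite mulr_gt0// subr_gt0.
  by rewrite exprn_gt0// addr_gt0// divr_gt0.
have r_ge0 : 0 <= r := sqrtr_ge0 _.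
have rho_le : \forall k \near \oo, rho k <= r.
  near=> k; rewrite rhoE ler_wsqrtr//; apply: sqr_rate_le.
  - rewrite b_gt0/= ler_wpM2l ?(ltW alpha_gt0)// lef_pV2 ?posrE//.
    by near: k.
  - by rewrite l0_gt0; near: k.
  - by rewrite l1_lt2 andbT; near: k.
(* For mu = (1 + r) / 2, the bound r + theta <= mu (1 - theta) amounts to theta <= (1 - r) / (3 +
   r), and 3 + r < 4. *)
have theta_le : \forall k \near \oo, theta k < (1 - r) / 4.
  by apply: (cvgr_lt _ eta_eps_cvg0); rewrite divr_gt0// subr_gt0.
pose mu := (1 + r) / 2.
have mu01 : 0 <= mu < 1 by rewrite /mu; lra.
have [K _ KP] : \forall k \near \oo, `|x k.+1 - xbar| <= mu * `|x k - xbar|.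
  near=> k; have rk : rho k <= r by near: k.
  have tk : theta k < (1 - r) / 4 by near: k.
  have t1 : theta k < 1 by lra.
  have sk : theta k < 1 -> `|x k.+1 - xbar| <=
    (rho k + theta k) / (1 - theta k) * `|x k - xbar| by near: k.
  apply: (le_trans (sk t1)); rewrite ler_wpM2r// ler_pdivrMr ?subr_gt0//.
  have := theta_ge0 k; rewrite /mu; nra.
exists mu, K; split=> // k Kk; split; first exact: KP.
have /andP[mu0 _] := mu01.
(* One factor mu is cancelled; the remaining bound with exponent k - K goes by induction on k -
   K. *)
rewrite addn1 exprS -mulrA ler_wpM2l//.
rewrite -(subnK Kk) addnK; elim: (k - K)%N => [|n IHn].
  by rewrite expr0 mul1r.
rewrite addSn exprS -mulrA; apply: (le_trans (KP _ _)); first exact: leq_addl.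
by rewrite ler_wpM2l.
Unshelve. all: by end_near. Qed.
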